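(* Let $\psi(Y)$ be a quantifier-free formula in one variable $Y$ such that $\neg Y\vee\neg\neg Y\vdash\psi(Y)$. Then any intermediate logic $\mathcal{L}$ which defines the regular connective $\exists Y.\,(X\leftrightarrow\psi(Y))$ proves $\vdash_{\mathcal{L}}\psi(P)$.
   Context: Formulas of second-order intuitionistic propositional logic are built from propositional variables and $\bot$ using $\wedge,\vee,\rightarrow$ and the propositional quantifiers $\forall X,\exists X$; $\neg A$ abbreviates $A\rightarrow\bot$ and $A\leftrightarrow B$ abbreviates $(A\rightarrow B)\wedge(B\rightarrow A)$. $\Gamma\vdash A$ denotes derivability in the standard Gentzen-style intuitionistic sequent calculus for this language (quantifiers may be instantiated by arbitrary formulas). An intermediate logic $\mathcal{L}$ is a logic obtained from a finitely axiomatizable intermediate propositional logic $L$ (between intuitionistic and classical propositional logic) by setting $\Gamma\vdash_{\mathcal{L}}A$ iff $\Gamma,\Lambda\vdash A$, where $\Lambda$ consists of the second-order universal closures of the axioms of $L$. $\mathcal{L}$ defines the connective $C(X)$ if there is a quantifier-free formula $\Psi(X)$ in the variable $X$ with $C(X)\vdash_{\mathcal{L}}\Psi(X)$ and $\Psi(X)\vdash_{\mathcal{L}}C(X)$. $P$ is an arbitrary propositional variable (equivalently, an arbitrary formula). *)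

(* Defs.v *)
From Stdlib Require Import List Permutation Arith.
Import ListNotations.

(** Formulas with de Bruijn indices: [All] and [Ex] bind index 0. *)
Inductive form : Type :=
| Var (n : nat)
| Bot
| And (A B : form)
| Or (A B : form)
| Imp (A B : form)
| All (A : form)
| Ex (A : form).

Definition Neg (A : form) : form := Imp A Bot.
Definition Iff (A B : form) : form := And (Imp A B) (Imp B A).

Fixpoint quantifier_free (A : form) : Prop :=
  match A with
  | Var _ | Bot => True
  | And B C | Or B C | Imp B C => quantifier_free B /\ quantifier_free C
  | All _ | Ex _ => False
  end.

(** The least [n] such that every free variable of [A] is [< n]. In particular
    [fv_bound A <= 1] says that [A] is a formula in the single variable
    [Var 0] (which need not actually occur). *)
Fixpoint fv_bound (A : form) : nat :=
  match A with
  | Var n => S n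
  | Bot => 0
  | And B C | Or B C | Imp B C => Nat.max (fv_bound B) (fv_bound C)
  | All B | Ex B => Nat.pred (fv_bound B)
  end.

Definition up_ren (r : nat -> nat) (n : nat) : nat :=
  match n with 0 => 0 | S m => S (r m) end.

Fixpoint ren (r : nat -> nat) (A : form) : form :=
  match A with
  | Var n => Var (r n)
  | Bot => Bot
  | And B C => And (ren r B) (ren r C)
  | Or B C => Or (ren r B) (ren r C)
  | Imp B C => Imp (ren r B) (ren r C)
  | All B => All (ren (up_ren r) B)
  | Ex B => Ex (ren (up_ren r) B)
  end.

Definition shift : form -> form := ren S.

Definition up (s : nat -> form) (n : nat) : form :=
  match n with 0 => Var 0 | S m => shift (s m) end.

Fixpoint subst (s : nat -> form) (A : form) : form :=
  match A with
  | Var n => s n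
  | Bot => Bot
  | And B C => And (subst s B) (subst s C)
  | Or B C => Or (subst s B) (subst s C)
  | Imp B C => Imp (subst s B) (subst s C)
  | All B => All (subst (up s) B)
  | Ex B => Ex (subst (up s) B)
  end.

(** [inst A B] is [A(B)]: index 0 is replaced by [B], and the remaining free
    indices are lowered by one. *)
Definition inst (A B : form) : form :=
  subst (fun n => match n with 0 => B | S m => Var m end) A.

(** LJ with explicit structural rules and cut, in context-sharing form. The
    eigenvariable conditions of [d_AllR] and [d_ExL] are expressed by shifting
    the side formulas, so that [Var 0] is fresh for them. *)
Inductive derives : list form -> form -> Prop :=
| d_Ax A : derives [A] A
| d_Cut G A C : derives G A -> derives (A :: G) C -> derives G C
| d_Weak G A C : derives G C -> derives (A :: G) C
| d_Contr G A C : derives (A :: A :: G) C -> derives (A :: G) C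
| d_Exch G G' C : Permutation G G' -> derives G C -> derives G' C
| d_BotL G C : derives (Bot :: G) C
| d_AndR G A B : derives G A -> derives G B -> derives G (And A B)
| d_AndL1 G A B C : derives (A :: G) C -> derives (And A B :: G) C
| d_AndL2 G A B C : derives (B :: G) C -> derives (And A B :: G) C
| d_OrR1 G A B : derives G A -> derives G (Or A B)
| d_OrR2 G A B : derives G B -> derives G (Or A B)
| d_OrL G A B C :
    derives (A :: G) C -> derives (B :: G) C -> derives (Or A B :: G) C
| d_ImpR G A B : derives (A :: G) B -> derives G (Imp A B)
| d_ImpL G A B C :
    derives G A -> derives (B :: G) C -> derives (Imp A B :: G) C
| d_AllR G A : derives (map shift G) A -> derives G (All A)
| d_AllL G A B C : derives (inst A B :: G) C -> derives (All A :: G) C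
| d_ExR G A B : derives G (inst A B) -> derives G (Ex A)
| d_ExL G A C :
    derives (A :: map shift G) (shift C) -> derives (Ex A :: G) C.

Definition int_axioms : list form :=
  let A := Var 0 in let B := Var 1 in let C := Var 2 in
  [ Imp A (Imp B A);
    Imp (Imp A (Imp B C)) (Imp (Imp A B) (Imp A C));
    Imp (And A B) A;
    Imp (And A B) B;
    Imp A (Imp B (And A B));
    Imp A (Or A B);
    Imp B (Or A B);
    Imp (Imp A C) (Imp (Imp B C) (Imp (Or A B) C));
    Imp Bot A ].

(** The least set of formulas that contains the intuitionistic axioms and [axs]
    and is closed under modus ponens and propositional substitution. *)
Inductive prop_theorem (axs : list form) : form -> Prop :=
| pt_int A : In A int_axioms -> prop_theorem axs A
| pt_ax A : In A axs -> prop_theorem axs A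
| pt_mp A B :
    prop_theorem axs (Imp A B) -> prop_theorem axs A -> prop_theorem axs B
| pt_subst s A :
    (forall n, quantifier_free (s n)) ->
    prop_theorem axs A -> prop_theorem axs (subst s A).

Definition IPC : form -> Prop := prop_theorem [].
Definition CPC : form -> Prop := prop_theorem [Or (Var 0) (Neg (Var 0))].

Record intermediate_prop_logic (L : form -> Prop) : Prop := {
  ipl_quantifier_free : forall A, L A -> quantifier_free A;
  ipl_IPC : forall A, IPC A -> L A;
  ipl_CPC : forall A, L A -> CPC A;
  ipl_mp : forall A B, L (Imp A B) -> L A -> L B;
  ipl_subst : forall s A,
    (forall n, quantifier_free (s n)) -> L A -> L (subst s A)
}.

Definition axiomatizes (axs : list form) (L : form -> Prop) : Prop :=
  Forall quantifier_free axs /\ (forall A, L A <-> prop_theorem axs A).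

(** Every free index of [A] is bound by the prefix, which may also contain
    vacuous quantifiers (for the indices below [fv_bound A] not occurring). *)
Definition univ_closure (A : form) : form := Nat.iter (fv_bound A) All A.

(** Derivability in the second-order logic given by a propositional logic with
    axioms [axs]. *)
Definition derives_in (axs G : list form) (A : form) : Prop :=
  derives (G ++ map univ_closure axs) A.

(** A connective [C(X)] is represented by a formula whose variable [X] is
    [Var 0]. *)
Definition defines (axs : list form) (C : form) : Prop :=
  exists Psi : form,
    quantifier_free Psi /\ fv_bound Psi <= 1 /\
    derives_in axs [C] Psi /\ derives_in axs [Psi] C.

(** [exists Y, X <-> psi(Y)], where [Y] is [Var 0] in [psi]: below the binder
    [Y] is still index 0, and [X], index 0 outside, becomes index 1. *)
Definition regular_connective (psi : form) : form := Ex (Iff (Var 1) psi).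

(* Main.v *)
Require Import Defs.
From Stdlib Require Import List.
Import ListNotations.
From Stdlib Require Import Permutation PeanoNat Lia.

(** Write [C(X)] for [exists Y, X <-> psi(Y)], let [Psi(X)] be its
    quantifier-free definition, and consider the three-element Heyting chain
    [zero < half < one], the simplest model of second-order intuitionistic
    logic that is not classical.

    If some axiom of the logic fails in the chain, the logic is classical:
    replacing each variable of that axiom by falsity, [P \/ ~P] or truth,
    according to the refuting valuation, turns the axiom into a formula that
    implies [P \/ ~P] ([excluded_middle_of_refuted_axiom]).  Excluded middle
    for [P] yields [~P \/ ~~P], hence [psi(P)].

    Otherwise the chain is a model of the logic.  Weak excluded middle holds in
    every chain, so [psi] is constantly [one] there and [C(half)] has value
    [half].  Since [Psi] implies [C] in the logic, soundness bounds the value of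
    [Psi] at [half] by [half].  Now the three values are not only a model but
    also a normal form: for a formula [Q] with [~~Q], the formulas [Bot], [Q]
    and [Bot -> Bot] are closed under the connectives up to provable
    equivalence, with exactly the tables of the chain ([chain_normal_form]).
    Hence [~~Q] and [Psi(Q)] together prove [Q].  Take [Q] to be [psi(P)]: it
    is dense because [~P \/ ~~P] is, and [Psi(Q)] is provable because [C(Q)]
    has the witness [P].  So [psi(P)] is provable. *)

(** * Substitution *)

Definition scons {T : Type} (x : T) (s : nat -> T) (n : nat) : T :=
  match n with 0 => x | S m => s m end.

Lemma subst_ext_below A : forall s t,
  (forall n, n < fv_bound A -> s n = t n) -> subst s A = subst t A.
Proof.
  induction A as [n| |A IHA B IHB|A IHA B IHB|A IHA B IHB|A IHA|A IHA];
    simpl; intros s t H; try (f_equal; auto with arith; fail).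
  1-3: f_equal; [apply IHA | apply IHB]; intros; apply H; lia.
  1-2: f_equal; apply IHA; intros [|n] Hn; simpl; auto;
       rewrite H by lia; reflexivity.
Qed.

Lemma subst_ext A s t : (forall n, s n = t n) -> subst s A = subst t A.
Proof. intros H; apply subst_ext_below; auto. Qed.

Lemma subst_Var A : forall s, (forall n, s n = Var n) -> subst s A = A.
Proof.
  induction A; simpl; intros s H; try f_equal; auto.
  all: apply IHA; intros [|n]; simpl; auto; rewrite H; reflexivity.
Qed.

Lemma ren_as_subst A : forall r, ren r A = subst (fun n => Var (r n)) A.
Proof.
  induction A; simpl; intros r; try f_equal; auto.
  all: rewrite IHA; apply subst_ext; intros [|n]; reflexivity.
Qed.

Lemma subst_ren A : forall s r, subst s (ren r A) = subst (fun n => s (r n)) A.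
Proof.
  induction A; simpl; intros s r; try f_equal; auto.
  all: rewrite IHA; apply subst_ext; intros [|n]; reflexivity.
Qed.

Lemma ren_subst A : forall s r, ren r (subst s A) = subst (fun n => ren r (s n)) A.
Proof.
  induction A; simpl; intros s r; try f_equal; auto.
  all: rewrite IHA; apply subst_ext; intros [|n]; simpl; auto.
  all: unfold shift;
       rewrite (ren_as_subst (ren S _)), (ren_as_subst (ren r _)), !subst_ren;
       reflexivity.
Qed.

Lemma subst_subst A : forall s t,
  subst t (subst s A) = subst (fun n => subst t (s n)) A.
Proof.
  induction A; simpl; intros s t; try f_equal; auto.
  all: rewrite IHA; apply subst_ext; intros [|n]; simpl; auto.
  all: unfold shift; rewrite subst_ren, ren_subst; reflexivity.
Qed.

Lemma inst_shift A B : inst (shift A) B = A.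
Proof. unfold inst, shift. rewrite subst_ren. now apply subst_Var. Qed.

Lemma inst_subst_up A s B : inst (subst (up s) A) B = subst (scons B s) A.
Proof.
  unfold inst. rewrite subst_subst. apply subst_ext.
  intros [|n]; simpl; auto. apply (inst_shift (s n) B).
Qed.

Lemma subst_closed A s : fv_bound A = 0 -> subst s A = A.
Proof.
  intros H. transitivity (subst Var A).
  - apply subst_ext_below; lia.
  - now apply subst_Var.
Qed.

Lemma shift_closed A : fv_bound A = 0 -> shift A = A.
Proof. intros H. unfold shift. rewrite ren_as_subst. now apply subst_closed. Qed.

Lemma univ_closure_closed A : fv_bound (univ_closure A) = 0.
Proof.
  unfold univ_closure.
  assert (H : forall n, fv_bound (Nat.iter n All A) = fv_bound A - n).
  { induction n as [|n IH]; simpl; [|rewrite IH]; lia. }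
  rewrite H; lia.
Qed.

(** * Derived rules of the sequent calculus *)

Lemma derives_incl G G' A : derives G A -> incl G G' -> derives G' A.
Proof.
  intros H Hincl.
  assert (Hall : derives (G ++ G') A).
  { apply d_Exch with (G' ++ G); [apply Permutation_app_comm|].
    clear Hincl. induction G'; simpl; auto using d_Weak. }
  clear H. induction G as [|B G IH]; auto.
  apply IH; [intros x Hx; apply Hincl; now right|].
  assert (HB : In B (G ++ G')) by (apply in_or_app; right; apply Hincl; now left).
  destruct (in_split _ _ HB) as (l1 & l2 & E).
  simpl in Hall. rewrite E in *.
  apply d_Exch with (B :: l1 ++ l2); [apply Permutation_middle|].
  apply d_Contr. eapply d_Exch; [|exact Hall].
  apply perm_skip, Permutation_sym, Permutation_middle.
Qed.

Lemma derives_hyp G A : In A G -> derives G A.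
Proof.
  intros H. apply derives_incl with [A]; [apply d_Ax|].
  intros x [<-|[]]; exact H.
Qed.

Lemma Imp_elim G A B : derives G (Imp A B) -> derives G A -> derives G B.
Proof.
  intros H1 H2. apply d_Cut with (Imp A B); auto.
  apply d_ImpL; auto. apply derives_hyp; now left.
Qed.

Lemma And_elim1 G A B : derives G (And A B) -> derives G A.
Proof.
  intros H. apply d_Cut with (And A B); auto.
  apply d_AndL1, derives_hyp; now left.
Qed.

Lemma And_elim2 G A B : derives G (And A B) -> derives G B.
Proof.
  intros H. apply d_Cut with (And A B); auto.
  apply d_AndL2, derives_hyp; now left.
Qed.

Lemma Or_elim G A B C :
  derives G (Or A B) -> derives (A :: G) C -> derives (B :: G) C -> derives G C.
Proof. intros H H1 H2. apply d_Cut with (Or A B); auto using d_OrL. Qed.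

Lemma Bot_elim G A : derives G Bot -> derives G A.
Proof. intros H. apply d_Cut with Bot; auto using d_BotL. Qed.

Lemma All_elim G A B : derives G (All A) -> derives G (inst A B).
Proof.
  intros H. apply d_Cut with (All A); auto.
  apply d_AllL with B, derives_hyp; now left.
Qed.

Lemma Iff_elim1 G A B : derives G (Iff A B) -> derives G A -> derives G B.
Proof. intros H. apply Imp_elim, (And_elim1 _ _ _ H). Qed.

Lemma Iff_elim2 G A B : derives G (Iff A B) -> derives G B -> derives G A.
Proof. intros H. apply Imp_elim, (And_elim2 _ _ _ H). Qed.

Lemma Iff_refl G A : derives G (Iff A A).
Proof. apply d_AndR; apply d_ImpR, derives_hyp; now left. Qed.

Lemma Iff_trans G A B C :
  derives G (Iff A B) -> derives G (Iff B C) -> derives G (Iff A C).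
Proof.
  intros H1 H2; apply d_AndR; apply d_ImpR.
  - apply (Iff_elim1 _ B); [now apply d_Weak|].
    apply (Iff_elim1 _ A); [now apply d_Weak|]. apply derives_hyp; now left.
  - apply (Iff_elim2 _ _ B); [now apply d_Weak|].
    apply (Iff_elim2 _ _ C); [now apply d_Weak|]. apply derives_hyp; now left.
Qed.

Lemma Iff_And G A A' B B' :
  derives G (Iff A A') -> derives G (Iff B B') ->
  derives G (Iff (And A B) (And A' B')).
Proof.
  intros HA HB. apply (d_Weak _ (And A B)) in HA as HA1, HB as HB1.
  apply (d_Weak _ (And A' B')) in HA, HB.
  apply d_AndR; apply d_ImpR; apply d_AndR.
  - apply (Iff_elim1 _ _ _ HA1), (And_elim1 _ _ B), derives_hyp; now left.
  - apply (Iff_elim1 _ _ _ HB1), (And_elim2 _ A), derives_hyp; now left.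
  - apply (Iff_elim2 _ _ _ HA), (And_elim1 _ _ B'), derives_hyp; now left.
  - apply (Iff_elim2 _ _ _ HB), (And_elim2 _ A'), derives_hyp; now left.
Qed.

Lemma Iff_Or G A A' B B' :
  derives G (Iff A A') -> derives G (Iff B B') ->
  derives G (Iff (Or A B) (Or A' B')).
Proof.
  intros HA HB. apply d_AndR; apply d_ImpR, d_OrL.
  - apply d_OrR1, (Iff_elim1 _ A); [now apply d_Weak | apply derives_hyp; now left].
  - apply d_OrR2, (Iff_elim1 _ B); [now apply d_Weak | apply derives_hyp; now left].
  - apply d_OrR1, (Iff_elim2 _ _ A'); [now apply d_Weak | apply derives_hyp; now left].
  - apply d_OrR2, (Iff_elim2 _ _ B'); [now apply d_Weak | apply derives_hyp; now left].
Qed.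

Lemma Iff_Imp G A A' B B' :
  derives G (Iff A A') -> derives G (Iff B B') ->
  derives G (Iff (Imp A B) (Imp A' B')).
Proof.
  intros HA HB. apply d_AndR; apply d_ImpR, d_ImpR.
  - apply (Iff_elim1 _ B); [now do 2 apply d_Weak|].
    apply (Imp_elim _ A); [apply derives_hyp; simpl; auto|].
    apply (Iff_elim2 _ _ A'); [now do 2 apply d_Weak | apply derives_hyp; now left].
  - apply (Iff_elim2 _ _ B'); [now do 2 apply d_Weak|].
    apply (Imp_elim _ A'); [apply derives_hyp; simpl; auto|].
    apply (Iff_elim1 _ A); [now do 2 apply d_Weak | apply derives_hyp; now left].
Qed.

(** Generalising on [Var 0] is always possible over closed hypotheses, so such
    derivations are stable under instantiation. *)
Lemma derives_inst G A B :
  Forall (fun H => fv_bound H = 0) G -> derives G A -> derives G (inst A B).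
Proof.
  intros HG HA. apply All_elim, d_AllR.
  replace (map shift G) with G; auto. clear HA.
  induction HG as [|H G HH HG IH]; simpl; auto.
  now rewrite shift_closed, <- IH.
Qed.

(** Eliminating the outermost quantifier of the prefix fixes the value of the
    highest index, hence the induction keeps a substitution [t] for the indices
    that are already instantiated. *)
Lemma iter_All_elim A : forall n s t,
  (forall m, s (n + m) = t m) ->
  derives [subst t (Nat.iter n All A)] (subst s A).
Proof.
  induction n as [|n IH]; intros s t H.
  - simpl. rewrite (subst_ext _ s t H). apply d_Ax.
  - cbn [Nat.iter nat_rect subst]. apply d_AllL with (s n).
    rewrite inst_subst_up. apply IH.
    intros [|m]; simpl; [now rewrite Nat.add_0_r|].
    now rewrite <- H, Nat.add_succ_r.
Qed.

Lemma univ_closure_elim A s : derives [univ_closure A] (subst s A).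
Proof.
  rewrite <- (subst_closed _ (fun m => s (fv_bound A + m)) (univ_closure_closed A)).
  now apply iter_All_elim.
Qed.

(** * The three-element chain *)

Inductive chain : Type := zero | half | one.

Definition leb (a b : chain) : bool :=
  match a, b with
  | zero, _ | half, half | half, one | one, one => true
  | _, _ => false
  end.

Definition le (a b : chain) : Prop := leb a b = true.
Definition meet (a b : chain) : chain := if leb a b then a else b.
Definition join (a b : chain) : chain := if leb a b then b else a.
Definition imp (a b : chain) : chain := if leb a b then one else b.
Definition inf (f : chain -> chain) : chain := meet (f zero) (meet (f half) (f one)).
Definition sup (f : chain -> chain) : chain := join (f zero) (join (f half) (f one)).

Fixpoint eval (v : nat -> chain) (A : form) : chain :=
  match A with
  | Var n => v n
  | Bot => zero
  | And B C => meet (eval v B) (eval v C)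
  | Or B C => join (eval v B) (eval v C)
  | Imp B C => imp (eval v B) (eval v C)
  | All B => inf (fun x => eval (scons x v) B)
  | Ex B => sup (fun x => eval (scons x v) B)
  end.

Lemma le_refl a : le a a.
Proof. now destruct a. Qed.

Lemma le_trans a b c : le a b -> le b c -> le a c.
Proof. now destruct a, b, c. Qed.

Lemma le_meet c a b : le c (meet a b) <-> le c a /\ le c b.
Proof. destruct a, b, c; cbv; intuition congruence. Qed.

Lemma le_join c a b : le c (join a b) <-> le c a \/ le c b.
Proof. destruct a, b, c; cbv; intuition congruence. Qed.

Lemma le_imp c a b : le c (imp a b) <-> le (meet c a) b.
Proof. destruct a, b, c; cbv; intuition congruence. Qed.

Lemma le_inf c f : le c (inf f) <-> forall x, le c (f x).
Proof.
  unfold inf; rewrite !le_meet. split; [|auto].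
  intros (? & ? & ?) []; auto.
Qed.

Lemma le_sup c f : le c (sup f) <-> exists x, le c (f x).
Proof.
  unfold sup; rewrite !le_join. split; [intros [?|[?|?]]; eauto|].
  intros [[] ?]; auto.
Qed.

Lemma le_one a : le one a <-> a = one.
Proof. destruct a; cbv; intuition congruence. Qed.

Lemma inf_ext f g : (forall x, f x = g x) -> inf f = inf g.
Proof. intros H. unfold inf. now rewrite !H. Qed.

Lemma sup_ext f g : (forall x, f x = g x) -> sup f = sup g.
Proof. intros H. unfold sup. now rewrite !H. Qed.

Lemma eval_ext A : forall v w, (forall n, v n = w n) -> eval v A = eval w A.
Proof.
  induction A; simpl; intros v w H; try (f_equal; auto; fail); auto.
  1: apply inf_ext. 2: apply sup_ext.
  all: intros x; apply IHA; intros [|n]; simpl; auto.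
Qed.

Lemma eval_ren A : forall v r, eval v (ren r A) = eval (fun n => v (r n)) A.
Proof.
  induction A; simpl; intros v r; try (f_equal; auto; fail); auto.
  1: apply inf_ext. 2: apply sup_ext.
  all: intros x; rewrite IHA; apply eval_ext; now intros [|n].
Qed.

Lemma eval_subst A : forall v s,
  eval v (subst s A) = eval (fun n => eval v (s n)) A.
Proof.
  induction A; simpl; intros v s; try (f_equal; auto; fail); auto.
  1: apply inf_ext. 2: apply sup_ext.
  all: intros x; rewrite IHA; apply eval_ext.
  all: intros [|n]; [reflexivity | apply eval_ren].
Qed.

Lemma eval_shift A x v : eval (scons x v) (shift A) = eval v A.
Proof. unfold shift. rewrite eval_ren. now apply eval_ext. Qed.

Lemma eval_inst A B v : eval v (inst A B) = eval (scons (eval v B) v) A.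
Proof. unfold inst. rewrite eval_subst. apply eval_ext; now intros [|n]. Qed.

Definition models (c : chain) (v : nat -> chain) (G : list form) : Prop :=
  forall A, In A G -> le c (eval v A).

Lemma models_cons c v A G :
  models c v (A :: G) <-> le c (eval v A) /\ models c v G.
Proof.
  unfold models; simpl; split.
  - intros H; split; auto.
  - intros [H1 H2] B [<-|HB]; auto.
Qed.

Lemma models_le c d v G : le d c -> models c v G -> models d v G.
Proof. intros Hd H A HA. apply le_trans with c; auto. Qed.

Lemma models_shift c v x G :
  models c v G -> models c (scons x v) (map shift G).
Proof.
  intros H A HA. apply in_map_iff in HA as (B & <- & HB).
  rewrite eval_shift. auto.
Qed.

Lemma soundness G A : derives G A ->
  forall c v, models c v G -> le c (eval v A).
Proof.
  induction 1; intros c v; try rewrite !models_cons; simpl; intros HG.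
  - tauto.
  - apply IHderives2. rewrite models_cons. auto.
  - apply IHderives; tauto.
  - apply IHderives. rewrite !models_cons. tauto.
  - apply IHderives. intros B HB. apply HG. now apply (Permutation_in B H).
  - destruct HG as [HG _]. apply le_trans with zero; auto. reflexivity.
  - rewrite le_meet; auto.
  - rewrite le_meet in HG. apply IHderives. rewrite models_cons. tauto.
  - rewrite le_meet in HG. apply IHderives. rewrite models_cons. tauto.
  - rewrite le_join; auto.
  - rewrite le_join; auto.
  - rewrite le_join in HG. destruct HG as [[HA|HB] HG].
    + apply IHderives1. rewrite models_cons; auto.
    + apply IHderives2. rewrite models_cons; auto.
  - rewrite le_imp. apply IHderives.
    pose proof (proj1 (le_meet _ c (eval v A)) (le_refl _)) as [Hc HA].
    rewrite models_cons. split; auto. now apply models_le with c.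
  - destruct HG as [Himp HG]. apply IHderives2. rewrite models_cons. split; auto.
    rewrite le_imp in Himp. apply le_trans with (meet c (eval v A)); auto.
    rewrite le_meet. auto using le_refl.
  - rewrite le_inf. intros x. apply IHderives. now apply models_shift.
  - destruct HG as [HA HG]. apply IHderives. rewrite models_cons. split; auto.
    rewrite eval_inst. rewrite le_inf in HA. apply HA.
  - rewrite le_sup. exists (eval v B). rewrite <- eval_inst. auto.
  - destruct HG as [HA HG]. rewrite le_sup in HA. destruct HA as [x Hx].
    rewrite <- (eval_shift C x). apply IHderives. rewrite models_cons.
    split; auto. now apply models_shift.
Qed.

Lemma iter_All_refuted A n : forall v,
  eval v (Nat.iter n All A) <> one -> exists w, eval w A <> one.
Proof.
  induction n as [|n IH]; simpl; intros v Hv; [eauto|].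
  destruct (eval (scons zero v) (Nat.iter n All A)) eqn:E0;
    [apply (IH (scons zero v)); congruence.. |].
  destruct (eval (scons half v) (Nat.iter n All A)) eqn:E1;
    [apply (IH (scons half v)); congruence.. |].
  destruct (eval (scons one v) (Nat.iter n All A)) eqn:E2;
    [apply (IH (scons one v)); congruence.. |].
  exfalso; apply Hv. unfold inf. now rewrite E0, E1, E2.
Qed.

Lemma all_one_or_refuted v G :
  models one v G \/ exists A, In A G /\ eval v A <> one.
Proof.
  induction G as [|A G [IH|(B & HB & Hv)]].
  - left. intros A [].
  - destruct (eval v A) eqn:E.
    1-2: right; exists A; simpl; split; [auto | congruence].
    left. rewrite models_cons, le_one. auto.
  - right. exists B. simpl; auto.
Qed.

(** The connective [exists Y, X <-> psi(Y)] does not collapse to [one] at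
    [half]: chains satisfy weak excluded middle, so no [Y] gives [psi] the
    value [half]. *)
Lemma regular_connective_half psi v :
  derives [Or (Neg (Var 0)) (Neg (Neg (Var 0)))] psi ->
  v 0 = half -> eval v (regular_connective psi) = half.
Proof.
  intros Hpsi Hv.
  assert (H : forall w, eval w psi = one).
  { intros w. apply le_one, (soundness _ _ Hpsi).
    intros A [<-|[]]. simpl. now destruct (w 0). }
  simpl. unfold sup. simpl. now rewrite Hv, !H.
Qed.

(** * Values of the chain as normal forms *)

Definition chain_form (Q : form) (a : chain) : form :=
  match a with zero => Bot | half => Q | one => Neg Bot end.

Lemma derives_Neg_Bot G : derives G (Neg Bot).
Proof. apply d_ImpR, derives_hyp; now left. Qed.

Lemma chain_form_mono G Q a b :
  le a b -> derives G (chain_form Q a) -> derives G (chain_form Q b).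
Proof.
  destruct a, b; simpl; intros Hle H; try discriminate Hle;
    auto using Bot_elim, derives_Neg_Bot.
Qed.

Lemma chain_form_meet G Q a b :
  derives G (Iff (And (chain_form Q a) (chain_form Q b)) (chain_form Q (meet a b))).
Proof.
  pose proof (proj1 (le_meet _ a b) (le_refl _)) as [Ha Hb].
  apply d_AndR; apply d_ImpR.
  - unfold meet; destruct (leb a b).
    + eapply And_elim1, derives_hyp; now left.
    + eapply And_elim2, derives_hyp; now left.
  - apply d_AndR; [apply (chain_form_mono _ _ _ _ Ha) | apply (chain_form_mono _ _ _ _ Hb)];
      apply derives_hyp; now left.
Qed.

Lemma chain_form_join G Q a b :
  derives G (Iff (Or (chain_form Q a) (chain_form Q b)) (chain_form Q (join a b))).
Proof.
  apply d_AndR; apply d_ImpR.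
  - apply d_OrL.
    + apply (chain_form_mono _ _ a); [|apply derives_hyp; now left].
      rewrite le_join; auto using le_refl.
    + apply (chain_form_mono _ _ b); [|apply derives_hyp; now left].
      rewrite le_join; auto using le_refl.
  - unfold join; destruct (leb a b); [apply d_OrR2 | apply d_OrR1];
      apply derives_hyp; now left.
Qed.

(** Density of [Q] enters through the entry [imp half zero = zero], which says
    that [~Q] is absurd; the other entries hold for every [Q]. *)
Lemma chain_form_imp G Q a b :
  derives G (Neg (Neg Q)) ->
  derives G (Iff (Imp (chain_form Q a) (chain_form Q b)) (chain_form Q (imp a b))).
Proof.
  intros HQ. apply d_AndR; apply d_ImpR.
  - destruct a, b; simpl; try apply derives_Neg_Bot.
    + apply (Imp_elim _ (Neg Q)); [now apply d_Weak|].
      apply derives_hyp; now left.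
    + apply (Imp_elim _ (Neg Bot)); [|apply derives_Neg_Bot].
      apply derives_hyp; now left.
    + apply (Imp_elim _ (Neg Bot)); [|apply derives_Neg_Bot].
      apply derives_hyp; now left.
  - apply d_ImpR. apply (chain_form_mono _ _ (meet (imp a b) a)).
    { apply le_imp, le_refl. }
    apply (Iff_elim1 _ _ _ (chain_form_meet _ Q (imp a b) a)).
    apply d_AndR; apply derives_hyp; simpl; auto.
Qed.

(** The formulas [Bot], [Q] and [Neg Bot] form a copy of the chain as soon as
    [Q] is dense, so substituting them for the variables of a quantifier-free
    formula yields, up to provable equivalence, the one named by its value. *)
Lemma chain_normal_form G Q v A :
  derives G (Neg (Neg Q)) -> quantifier_free A ->
  derives G (Iff (subst (fun n => chain_form Q (v n)) A) (chain_form Q (eval v A))).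
Proof.
  intros HQ.
  induction A as [n| |A IHA B IHB|A IHA B IHB|A IHA B IHB|A IHA|A IHA];
    simpl; intros Hqf; try contradiction.
  - apply Iff_refl.
  - apply Iff_refl.
  - destruct Hqf.
    eapply Iff_trans; [apply Iff_And; auto | apply chain_form_meet].
  - destruct Hqf.
    eapply Iff_trans; [apply Iff_Or; auto | apply chain_form_join].
  - destruct Hqf.
    eapply Iff_trans; [apply Iff_Imp; auto | now apply chain_form_imp].
Qed.

Lemma dense_of_refuted_value G Q v A :
  derives G (Neg (Neg Q)) -> quantifier_free A -> eval v A <> one ->
  derives G (subst (fun n => chain_form Q (v n)) A) -> derives G Q.
Proof.
  intros HQ Hqf Hv HA. apply (chain_form_mono _ Q (eval v A) half).
  - now destruct (eval v A).
  - exact (Iff_elim1 _ _ _ (chain_normal_form _ _ _ _ HQ Hqf) HA).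
Qed.

(** * Excluded middle and weak excluded middle *)

Lemma Neg_Neg_excluded_middle G P : derives G (Neg (Neg (Or P (Neg P)))).
Proof.
  apply d_ImpR. apply (Imp_elim _ (Or P (Neg P))); [apply derives_hyp; now left|].
  apply d_OrR2, d_ImpR.
  apply (Imp_elim _ (Or P (Neg P))); [apply derives_hyp; simpl; auto|].
  apply d_OrR1, derives_hyp; now left.
Qed.

Lemma weak_excluded_middle_of_excluded_middle G P :
  derives G (Or P (Neg P)) -> derives G (Or (Neg P) (Neg (Neg P))).
Proof.
  intros H. apply (Or_elim _ _ _ _ H).
  - apply d_OrR2, d_ImpR. apply (Imp_elim _ P); apply derives_hyp; simpl; auto.
  - apply d_OrR1, derives_hyp; now left.
Qed.

Lemma Neg_Neg_mono G A B :
  derives G (Imp A B) -> derives G (Neg (Neg A)) -> derives G (Neg (Neg B)).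
Proof.
  intros HAB HA. apply d_ImpR. apply (Imp_elim _ (Neg A)); [now apply d_Weak|].
  apply d_ImpR. apply (Imp_elim _ B); [apply derives_hyp; simpl; auto|].
  apply (Imp_elim _ A); [now do 2 apply d_Weak | apply derives_hyp; now left].
Qed.

(** An axiom that fails in the chain makes the logic classical, because
    [P \/ ~P] is dense and can play the role of [half]. *)
Lemma excluded_middle_of_refuted_axiom G A v P :
  quantifier_free A -> eval v A <> one -> derives G (univ_closure A) ->
  derives G (Or P (Neg P)).
Proof.
  intros Hqf Hv HA.
  apply (dense_of_refuted_value _ _ v A (Neg_Neg_excluded_middle _ _) Hqf Hv).
  apply d_Cut with (univ_closure A); auto.
  apply derives_incl with [univ_closure A]; [apply univ_closure_elim|].
  intros x [<-|[]]; now left.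
Qed.

(** * Provability of [psi(P)] from definability *)

Lemma inst_regular_connective psi B :
  fv_bound psi <= 1 ->
  inst (regular_connective psi) B = Ex (Iff (shift B) psi).
Proof.
  intros Hpsi. unfold inst, regular_connective. simpl.
  rewrite (subst_ext_below psi _ Var), (subst_Var psi Var); auto.
  intros [|n] Hn; [reflexivity | lia].
Qed.

Lemma regular_connective_at_value G psi P :
  fv_bound psi <= 1 ->
  derives G (inst (regular_connective psi) (inst psi P)).
Proof.
  intros Hpsi. rewrite inst_regular_connective by assumption.
  apply d_ExR with P.
  change (derives G (Iff (inst (shift (inst psi P)) P) (inst psi P))).
  rewrite inst_shift. apply Iff_refl.
Qed.

Theorem corollary4p16
  (psi : form)
  (psi_qf : quantifier_free psi)
  (psi_var : fv_bound psi <= 1)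
  (psi_wem : derives [Or (Neg (Var 0)) (Neg (Neg (Var 0)))] psi)
  (L : form -> Prop) (axs : list form)
  (L_intermediate : intermediate_prop_logic L)
  (L_axioms : axiomatizes axs L)
  (L_defines : defines axs (regular_connective psi))
  (P : form) :
  derives_in axs [] (inst psi P).
Proof.
  destruct L_axioms as [axs_qf _].
  destruct L_defines as (Psi & Psi_qf & Psi_var & C_Psi & Psi_C).
  unfold derives_in in *. simpl app in *.
  set (G := map univ_closure axs) in *.
  assert (G_closed : Forall (fun H => fv_bound H = 0) G).
  { apply Forall_forall. intros A HA.
    apply in_map_iff in HA as (B & <- & _). apply univ_closure_closed. }
  assert (wem_psi : derives G (Imp (Or (Neg P) (Neg (Neg P))) (inst psi P))).
  { apply derives_incl with []; [|intros x []].
    apply d_ImpR in psi_wem. exact (derives_inst _ _ P (Forall_nil _) psi_wem). }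
  destruct (all_one_or_refuted (fun _ => half) G) as [G_one | (A & HA & A_refuted)].
  (* The chain is a model of the logic: prove [Psi(Q)] for [Q] := [psi(P)]. *)
  - assert (Psi_half : eval (fun _ => half) Psi <> one).
    { intros E.
      assert (H : le one (eval (fun _ => half) (regular_connective psi))).
      { apply (soundness _ _ Psi_C). rewrite models_cons, E. split; auto. reflexivity. }
      rewrite (regular_connective_half psi _ psi_wem eq_refl) in H.
      discriminate H. }
    apply (dense_of_refuted_value _ _ (fun _ => half) Psi); auto.
    + apply (Neg_Neg_mono _ _ _ wem_psi).
      apply Neg_Neg_mono with (Or P (Neg P)); [|apply Neg_Neg_excluded_middle].
      apply d_ImpR, weak_excluded_middle_of_excluded_middle, derives_hyp; now left.
    (* [Psi] has the single variable [Var 0], where the constant valuation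
       [half] puts [Q]. *)
    + rewrite (subst_ext_below Psi _ (fun n => match n with 0 => inst psi P | S m => Var m end)).
      2: intros [|n] Hn; [reflexivity | lia].
      apply d_ImpR in C_Psi.
      apply (Imp_elim _ (inst (regular_connective psi) (inst psi P))).
      * exact (derives_inst _ _ (inst psi P) G_closed C_Psi).
      * now apply regular_connective_at_value.
  (* Some axiom fails in the chain: the logic is classical. *)
  - pose proof HA as HA'. apply in_map_iff in HA' as (B & <- & HB).
    destruct (iter_All_refuted _ _ _ A_refuted) as [w Hw].
    apply (Imp_elim _ _ _ wem_psi), weak_excluded_middle_of_excluded_middle.
    apply (excluded_middle_of_refuted_axiom _ B w); auto using derives_hyp.
    rewrite Forall_forall in axs_qf. auto.
Qed.
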